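(* Let $r(n)$ be the largest root of the equation $x^3-(3n-7)x^2+n(2n-7)x-2(n^2-7n+12)=0$. Then $q_1(K_{n-3}\vee K_1\vee \overline{K_2})=r(n)$ for every even integer $n\geq 4$. Moreover, $q_1(K_2\vee\overline{K_4})=4+2\sqrt{3}$ and $q_1(K_3\vee\overline{K_5})=6+2\sqrt{6}$.
   Context: For a simple graph $G$, $Q(G)=D(G)+A(G)$ is the signless Laplacian matrix ($D(G)$ the diagonal degree matrix, $A(G)$ the adjacency matrix), and $q_1(G)$ is its largest eigenvalue. $K_m$ is the complete graph on $m$ vertices and $\overline{K_m}$ its complement (the edgeless graph on $m$ vertices). The join $G_1\vee G_2$ of two vertex-disjoint graphs is the graph on $V(G_1)\cup V(G_2)$ with edge set $E(G_1)\cup E(G_2)\cup\{uv: u\in V(G_1), v\in V(G_2)\}$; $K_{n-3}\vee K_1\vee\overline{K_2}$ means $(K_{n-3}\vee K_1)\vee\overline{K_2}$ is NOT intended; rather it is the graph obtained by joining $K_{n-3}$ to a single vertex $K_1$ and joining that same vertex to $\overline{K_2}$, with no edges between $K_{n-3}$ and $\overline{K_2}$ (i.e., a clique on $n-2$ vertices, one of whose vertices is additionally adjacent to two further vertices of degree $1$). *)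

(* Defs.v *)
From mathcomp Require Import all_boot all_order all_algebra.

Set Implicit Arguments.
Unset Strict Implicit.
Unset Printing Implicit Defensive.

Import Order.TTheory GRing.Theory Num.Theory.

Local Open Scope ring_scope.

Record sgraph := SGraph {
  vertex : finType;
  adj : rel vertex;
  adj_sym : symmetric adj;
  adj_irr : irreflexive adj }.

Definition degree (G : sgraph) (u : vertex G) : nat := #|[set v | adj u v]|.

Fact complete_sym (m : nat) : symmetric (fun i j : 'I_m => i != j).
Proof. by move=> i j; rewrite eq_sym. Qed.

Fact complete_irr (m : nat) : irreflexive (fun i j : 'I_m => i != j).
Proof. by move=> i; rewrite eqxx. Qed.

Definition complete (m : nat) : sgraph :=
  SGraph (@complete_sym m) (@complete_irr m).

Definition compl_adj (G : sgraph) : rel (vertex G) :=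
  fun u v => (u != v) && ~~ adj u v.

Fact compl_sym (G : sgraph) : symmetric (@compl_adj G).
Proof. by move=> u v; rewrite /compl_adj eq_sym adj_sym. Qed.

Fact compl_irr (G : sgraph) : irreflexive (@compl_adj G).
Proof. by move=> u; rewrite /compl_adj eqxx. Qed.

Definition compl (G : sgraph) : sgraph := SGraph (@compl_sym G) (@compl_irr G).

Definition join_adj (G1 G2 : sgraph) : rel (vertex G1 + vertex G2)%type :=
  fun u v => match u, v with
  | inl x, inl y => adj x y
  | inr x, inr y => adj x y
  | _, _ => true
  end.

Fact join_sym (G1 G2 : sgraph) : symmetric (@join_adj G1 G2).
Proof. by move=> [x|x] [y|y] //=; rewrite adj_sym. Qed.

Fact join_irr (G1 G2 : sgraph) : irreflexive (@join_adj G1 G2).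
Proof. by move=> [x|x] /=; rewrite adj_irr. Qed.

Definition join (G1 G2 : sgraph) : sgraph :=
  SGraph (@join_sym G1 G2) (@join_irr G1 G2).

(* The sequential join, written G1 v G2 v G3 in the literature: G1 is joined
   to G2 and G2 to G3, with no edge between G1 and G3.  It differs from the
   iterated join, in which G1 and G3 are joined as well. *)
Definition seq_join_adj (G1 G2 G3 : sgraph) :
    rel (vertex G1 + vertex (join G2 G3))%type :=
  fun u v => match u, v with
  | inl x, inl y => adj x y
  | inr x, inr y => adj x y
  | inl _, inr w | inr w, inl _ => if w is inl _ then true else false
  end.

Fact seq_join_sym (G1 G2 G3 : sgraph) : symmetric (@seq_join_adj G1 G2 G3).
Proof.
by move=> [x|x] [y|y]; rewrite /seq_join_adj // adj_sym.
Qed.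

Fact seq_join_irr (G1 G2 G3 : sgraph) : irreflexive (@seq_join_adj G1 G2 G3).
Proof. by move=> [x|x]; rewrite /seq_join_adj adj_irr. Qed.

Definition seq_join (G1 G2 G3 : sgraph) : sgraph :=
  SGraph (@seq_join_sym G1 G2 G3) (@seq_join_irr G1 G2 G3).

(* Rows and columns are indexed by the vertices through enum_val. *)
Definition adjacency (R : pzRingType) (G : sgraph) : 'M[R]_#|vertex G| :=
  \matrix_(i, j) (adj (enum_val i) (enum_val j))%:R.

Definition degree_mx (R : pzRingType) (G : sgraph) : 'M[R]_#|vertex G| :=
  diag_mx (\row_i (degree (enum_val i))%:R).

Definition signless_laplacian (R : pzRingType) (G : sgraph) :
    'M[R]_#|vertex G| :=
  degree_mx R G + adjacency R G.

Definition is_largest (R : numDomainType) (P : R -> Prop) (x : R) : Prop :=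
  P x /\ forall y, P y -> y <= x.

(* is_q1 G x reads q_1(G) = x; such an x is unique by antisymmetry of <=. *)
Definition is_q1 (R : realFieldType) (G : sgraph) (x : R) : Prop :=
  is_largest (fun a => eigenvalue (signless_laplacian R G) a) x.

(* Main.v *)
(** A positive eigenvector of a nonnegative symmetric matrix belongs to its
    largest eigenvalue.  In each graph below a vector that is constant on the
    parts of the join is an eigenvector as soon as its values solve the quotient
    system of the partition, so it suffices to exhibit a positive solution.
    For the cubic, which is the characteristic polynomial of the 3 x 3 quotient,
    the solution attached to a root [r] is positive when [r > 1] and
    [r > 2n - 7]. *)
Require Import Defs.
From mathcomp Require Import all_boot all_order all_algebra.
From mathcomp Require Import ring lra.

Import Order.TTheory GRing.Theory Num.Theory.

Local Open Scope ring_scope.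

Lemma signless_laplacianE (R : pzRingType) (G : sgraph) i j :
  signless_laplacian R G i j =
    (degree (enum_val i))%:R *+ (i == j) + (adj (enum_val i) (enum_val j))%:R.
Proof.
by rewrite !mxE; case: (i == j).
Qed.

Lemma signless_laplacian_sym (R : pzRingType) (G : sgraph) :
  (signless_laplacian R G)^T = signless_laplacian R G.
Proof.
apply/matrixP=> i j; rewrite mxE !signless_laplacianE adj_sym eq_sym.
by case: eqP => [->|].
Qed.

Lemma degreeE (R : pzRingType) (G : sgraph) (u : vertex G) :
  (degree u)%:R = \sum_v (adj u v)%:R :> R.
Proof.
rewrite /degree -sum1_card natr_sum big_mkcond.
by apply: eq_bigr => v _; rewrite inE; case: adj.
Qed.

Lemma sum_enum_val (V : nmodType) (T : finType) (F : T -> V) :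
  \sum_(i < #|T|) F (enum_val i) = \sum_x F x.
Proof. by rewrite -(big_enum_val (A := T)). Qed.

(** Writing the degree as a sum of adjacencies merges the diagonal term into the sum over
    neighbours. *)
Lemma row_mul_signless_laplacian (R : comPzRingType) (G : sgraph)
    (w : vertex G -> R) j :
  ((\row_i w (enum_val i)) *m signless_laplacian R G) 0 j =
    \sum_v (adj (enum_val j) v)%:R * (w (enum_val j) + w v).
Proof.
rewrite mxE.
under eq_bigr => i _.
  rewrite mxE signless_laplacianE mulrDr mulrnAr adj_sym (mulrC _ (adj _ _)%:R).
  over.
under [RHS]eq_bigr => i _ do rewrite mulrDr.
rewrite !big_split /=; congr (_ + _).
rewrite (bigD1 j) //= eqxx big1 => [|i /negPf -> //].
  by rewrite addr0 mulrC degreeE mulr_suml.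
by rewrite -(sum_enum_val _ _ (fun v => (adj (enum_val j) v)%:R * w v)).
Qed.

(** Pair a left eigenvector [v] for [y] with [w]. The triangle inequality gives [|y| |v| <= |v| M]
    entrywise, and multiplying by [w] turns the right side into [r] times the pairing of [|v|] with
    [w], a positive number that cancels. *)
Lemma eigenvalue_le_of_pos (R : realFieldType) n (M : 'M[R]_n) (w : 'cV[R]_n)
    (r y : R) :
  (forall i j, 0 <= M i j) -> (forall i, 0 < w i 0) -> M *m w = r *: w ->
  eigenvalue M y -> y <= r.
Proof.
move=> M0 w0 Mw /eigenvalueP[v vM vn0].
have s_gt0 : 0 < \sum_j `|v 0 j| * w j 0.
  have [j vj] : exists j, v 0 j != 0 by apply/rV0Pn.
  rewrite (bigD1 j) //= ltr_pwDl ?mulr_gt0 ?normr_gt0 //.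
  by apply: sumr_ge0 => i _; rewrite mulr_ge0 // ltW.
rewrite -(ler_pM2r s_gt0) (le_trans (ler_norm _)) // normrM (gtr0_norm s_gt0).
have -> : r * (\sum_j `|v 0 j| * w j 0) =
    \sum_j (\sum_i `|v 0 i| * M i j) * w j 0.
  rewrite mulr_sumr; under [RHS]eq_bigr do rewrite mulr_suml.
  rewrite exchange_big; apply: eq_bigr => i _ /=.
  under eq_bigr do rewrite -mulrA.
  rewrite -mulr_sumr; have /matrixP/(_ i 0) := Mw; rewrite !mxE => ->.
  by rewrite mulrCA.
rewrite mulr_sumr; apply: ler_sum => j _; rewrite mulrA -normrM.
apply: ler_wpM2r; first exact: ltW.
have /matrixP/(_ 0 j) := vM; rewrite !mxE => <-.
apply: le_trans (ler_norm_sum _ _ _) _.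
by apply: ler_sum => i _; rewrite normrM (ger0_norm (M0 _ _)).
Qed.

Lemma is_q1_of_pos (R : realFieldType) (G : sgraph) (u0 : vertex G)
    (w : vertex G -> R) (r : R) :
  (forall u, 0 < w u) ->
  (forall u, \sum_v (adj u v)%:R * (w u + w v) = r * w u) -> is_q1 G r.
Proof.
move=> w0 wE; pose W : 'rV[R]_#|vertex G| := \row_i w (enum_val i).
have WM : W *m signless_laplacian R G = r *: W.
  by apply/rowP=> j; rewrite row_mul_signless_laplacian wE !mxE.
split=> [|y].
  apply/eigenvalueP; exists W => //; apply/rV0Pn; exists (enum_rank u0).
  by rewrite mxE gt_eqF.
apply: (@eigenvalue_le_of_pos _ _ _ W^T) => [i j|i|].
- by rewrite signless_laplacianE addr_ge0 ?mulrn_wge0 ?ler0n.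
- by rewrite !mxE.
(* [eigenvalue] concerns row vectors, the bound above a column; symmetry turns one into the
   other. *)
- by rewrite -[X in X *m _]signless_laplacian_sym -trmx_mul WM linearZ.
Qed.

Lemma sum_neq (R : pzRingType) m (c : R) (i : 'I_m) :
  \sum_(j < m) (i != j)%:R * c = (m%:R - 1) * c.
Proof.
rewrite -mulr_suml; congr (_ * _); apply/eqP.
rewrite -subr_eq opprK eq_sym -[m in X in X == _]card_ord -sumr_const.
rewrite (bigD1 i) //= addrC; apply/eqP; congr (_ + _).
rewrite [in RHS](bigD1 i) //= eqxx add0r.
by apply: eq_bigr => j; rewrite eq_sym => ->.
Qed.

Lemma compl_complete_adj m (i j : 'I_m) : @adj (compl (complete m)) i j = false.
Proof. exact: andbN. Qed.

Lemma sum_compl_complete (R : pzRingType) m (F : 'I_m -> R) (i : 'I_m) :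
  \sum_(j < m) (@adj (compl (complete m)) i j)%:R * F j = 0.
Proof. by apply: big1 => j _; rewrite compl_complete_adj mul0r. Qed.

Lemma is_q1_join_complete_compl (R : realFieldType) s t (a b x : R) :
  0 < a -> 0 < b ->
  (s.+1%:R - 1) * (a + a) + t%:R * (a + b) = x * a ->
  s.+1%:R * (b + a) = x * b ->
  is_q1 (join (complete s.+1) (compl (complete t))) x.
Proof.
move=> a0 b0 aE bE.
pose w (u : 'I_s.+1 + 'I_t) := if u is inl _ then a else b.
apply: (@is_q1_of_pos R (join (complete s.+1) (compl (complete t)))
  (inl ord0) w) => [[]//|[i|i]]; rewrite big_sumType /=.
- by rewrite sum_neq sumr_const card_ord mul1r -[_ *+ t]mulr_natl.
- by rewrite sum_compl_complete addr0 sumr_const card_ord mul1r -mulr_natl.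
Qed.

Lemma is_q1_seq_join_complete (R : realFieldType) m t (a h p x : R) :
  0 < a -> 0 < h -> 0 < p ->
  (m%:R - 1) * (a + a) + (a + h) = x * a ->
  m%:R * (h + a) + t%:R * (h + p) = x * h ->
  p + h = x * p ->
  is_q1 (seq_join (complete m) (complete 1) (compl (complete t))) x.
Proof.
move=> a0 h0 p0 aE hE pE.
pose w (u : 'I_m + ('I_1 + 'I_t)) :=
  match u with inl _ => a | inr (inl _) => h | inr (inr _) => p end.
apply: (@is_q1_of_pos R
  (seq_join (complete m) (complete 1) (compl (complete t)))
  (inr (inl ord0)) w) => [[|[]]//|[i|[i|i]]]; rewrite !big_sumType /=.
- by rewrite sum_neq big_ord1 mul1r big1 ?addr0 // => j _; rewrite mul0r.
- rewrite sum_neq subrr mul0r add0r !sumr_const !card_ord !mul1r.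
  by rewrite -[_ *+ m]mulr_natl -[_ *+ t]mulr_natl.
- rewrite sum_compl_complete big_ord1 mul1r addr0 big1 ?add0r // => j _.
  by rewrite mul0r.
Qed.

Definition cubic (R : pzRingType) (n x : R) : R :=
  x ^+ 3 - (3 * n - 7) * x ^+ 2 + n * (2 * n - 7) * x
    - 2 * (n ^+ 2 - 7 * n + 12).

Lemma is_q1_cubic_root (R : realFieldType) n (x : R) :
  (3 <= n)%N -> 1 < x -> 2 * n%:R - 7 < x -> cubic R n%:R x = 0 ->
  is_q1 (seq_join (complete (n - 3)) (complete 1) (compl (complete 2))) x.
Proof.
move=> n3 x1 xn; rewrite /cubic => x0.
(* The pendant equation forces [h = (x - 1) p] and the clique equation [h = (x - (2n - 7)) a]. These
   values satisfy both, and the hub equation that remains is the cubic. *)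
apply: (@is_q1_seq_join_complete _ _ _ (x - 1) ((x - 1) * (x - (2 * n%:R - 7)))
  (x - (2 * n%:R - 7))); rewrite ?mulr_gt0 ?subr_gt0 //; rewrite ?natrB //.
- ring.
- by apply/eqP; rewrite -subr_eq0 -oppr_eq0 -x0; apply/eqP; ring.
- ring.
Qed.

(** Intermediate value theorem between a point above both bounds, where the cubic is negative, and
    [2 * n]. *)
Lemma cubic_root_gt (R : rcfType) n : (4 <= n)%N ->
  exists2 r : R, 1 < r /\ 2 * n%:R - 7 < r & cubic R n%:R r = 0.
Proof.
rewrite -(ler_nat R) => n4; set N : R := n%:R in n4 *.
pose p : {poly R} := 'X^3 - (3 * N - 7)%:P * 'X^2 + (N * (2 * N - 7))%:P * 'X
  - (2 * (N ^+ 2 - 7 * N + 12))%:P.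
have pE x : p.[x] = cubic R N x by rewrite /p /cubic !hornerE.
(* At [2N - 7] the cubic is [-2 (N - 3) (N - 4)], which vanishes for [N = 4]; the maximum selects
   that point only when [N >= 6]. Also [N - 1 >= 3] secures [r > 1]. *)
pose c := Num.max (N - 1) (2 * N - 7).
have cn : N - 1 <= c by rewrite le_max lexx.
have cn' : 2 * N - 7 <= c by rewrite le_max lexx orbT.
have c2n : c <= 2 * N by rewrite ge_max; apply/andP; split; lra.
have pc : p.[c] < 0.
  rewrite pE /c; case: (leP (N - 1)) => [le|lt].
    have -> : cubic R N (2 * N - 7) = - (2 * (N - 3) * (N - 4)).
      by rewrite /cubic; ring.
    by rewrite oppr_lt0 !mulr_gt0; lra.
  have -> : cubic R N (N - 1) = - ((N - 3) * (N - 4) + 6).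
    by rewrite /cubic; ring.
  by nra.
have p2n : 0 <= p.[2 * N].
  have -> : p.[2 * N] = 12 * N ^+ 2 + 14 * N - 24 by rewrite pE /cubic; ring.
  by nra.
have [|r /andP[cr _] /rootP pr] := poly_ivt c2n (p := p).
  by rewrite ltW.
exists r; last by rewrite -pE.
have {}cr : c < r.
  by rewrite lt_neqAle cr andbT; apply: contraTneq pc => ->; rewrite pr ltxx.
split; lra.
Qed.

Theorem theorem4p1 (R : rcfType) :
  [/\ forall n : nat, ~~ odd n -> (4 <= n)%N ->
        exists2 r : R,
          is_largest (fun x : R =>
            x ^+ 3 - (3 * n%:R - 7) * x ^+ 2 + n%:R * (2 * n%:R - 7) * x
              - 2 * (n%:R ^+ 2 - 7 * n%:R + 12) = 0) r
        & is_q1 (seq_join (complete (n - 3)) (complete 1)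
                   (compl (complete 2))) r,
      is_q1 (join (complete 2) (compl (complete 4))) (4 + 2 * Num.sqrt 3 : R)
    & is_q1 (join (complete 3) (compl (complete 5))) (6 + 2 * Num.sqrt 6 : R)].
Proof.
split.
- move=> n _ n4; have [r [r1 rn] r0] := @cubic_root_gt R n n4.
  have n3 := ltnW n4.
  have qr := is_q1_cubic_root _ _ _ n3 r1 rn r0.
  (* A root [y] above [r] inherits both lower bounds, so it is an eigenvalue too, against the
     maximality of [r]. *)
  exists r => //; split=> // y y0; rewrite leNgt; apply/negP=> ry.
  have [ey _] :=
    is_q1_cubic_root _ _ _ n3 (lt_trans r1 ry) (lt_trans rn ry) y0.
  by move: ry; rewrite ltNge (qr.2 _ ey).
- have s0 : 0 <= Num.sqrt 3 :> R := sqrtr_ge0 _.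
  have s2 : Num.sqrt 3 ^+ 2 = 3 :> R by rewrite sqr_sqrtr.
  (* With [b = 1], the equation [2 (b + a) = x b] yields [a = x / 2 - 1]. *)
  apply: (@is_q1_join_complete_compl _ _ _ (1 + Num.sqrt 3) 1); nra.
- have s0 : 0 <= Num.sqrt 6 :> R := sqrtr_ge0 _.
  have s2 : Num.sqrt 6 ^+ 2 = 6 :> R by rewrite sqr_sqrtr.
  (* Here [3 (b + a) = x b]; taking [b = 3] clears the denominator and gives [a = x - 3]. *)
  apply: (@is_q1_join_complete_compl _ _ _ (3 + 2 * Num.sqrt 6) 3); nra.
Qed.
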